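(* Let $\lambda_0,\lambda_1,\lambda_2$ be distinct real numbers and let $s\ge1$ be an integer. (1) Let $J$ be the usual complex structure on $\mathbb{R}^{(0,2s)}=\mathbb{C}^s$, and let $R=c_0R_{\mathrm{Id}}+c_1R_J$. One can choose real constants $c_0,c_1$ so that, for every complex line $\pi$, $JR(\pi)$ has eigenvalues $\lambda_0$ and $\lambda_1$ with multiplicities $\mu_0=s-1$ and $\mu_1=1$ on $\mathbb{C}^s$. (2) Let $\{i,j,k\}$ be the usual skew-adjoint quaternion structure on $\mathbb{R}^{(0,4s)}=\mathbb{C}^{2s}$, let $J=i$, and let $R=c_0R_{\mathrm{Id}}+c_1R_i+c_2R_j+c_3R_k$. (a) One can choose real constants $c_0,c_1,c_2,c_3$ so that, for every complex line $\pi$, $JR(\pi)$ has eigenvalues $\lambda_0$ and $\lambda_1$ with multiplicities $\mu_0=2s-2$ and $\mu_1=2$ on $\mathbb{C}^{2s}$. (b) One can choose real constants $c_0,c_1,c_2,c_3$ so that, for every complex line $\pi$, $JR(\pi)$ has eigenvalues $\lambda_0$, $\lambda_1$ and $\lambda_2$ with multiplicities $\mu_0=2s-2$, $\mu_1=1$ and $\mu_2=1$ on $\mathbb{C}^{2s}$.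
   Context: $\mathbb{R}^{(0,q)}$ is $\mathbb{R}^q$ with its standard positive definite inner product $(\cdot,\cdot)$. The complex structure on the real vector space $V$ is given by $\sqrt{-1}\,x:=Jx$, where $J$ is an isometry with $J^2=-\mathrm{Id}$; the operators $JR(\pi)$ are complex linear, and eigenvalue multiplicities are complex multiplicities (dimensions over $\mathbb{C}$ of the eigenspaces). A multiplicity equal to $0$ means that the value in question does not occur as an eigenvalue. A skew-adjoint quaternion structure is a triple $\{i,j,k\}$ of skew-adjoint linear maps satisfying $i^2=j^2=k^2=-\mathrm{Id}$, $ij=-ji=k$, $jk=-kj=i$, $ki=-ik=j$; the usual one on $\mathbb{R}^{4s}=\mathbb{H}^s$ is given by quaternion multiplication by the units $i,j,k$. If $\phi$ is a self-adjoint linear map of $V$, define $R_\phi(x,y,z,w):=(\phi y,z)(\phi x,w)-(\phi x,z)(\phi y,w)$. If $\phi$ is skew-adjoint, define $R_\phi(x,y,z,w):=(\phi y,z)(\phi x,w)-(\phi x,z)(\phi y,w)-2(\phi x,y)(\phi z,w)$. For a 4-tensor $R$, the curvature operator $R(x,y):V\to V$ is defined by $(R(x,y)z,w)=R(x,y,z,w)$. If $\{x,y\}$ is an oriented basis of an oriented 2-plane $\pi$, set $R(\pi):=|(x,x)(y,y)-(x,y)^2|^{-1/2}R(x,y)$. A 2-plane $\pi$ is a complex line if $J\pi=\pi$; complex lines are oriented by bases of the form $\{x,Jx\}$. *)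

(* Defs.v *)
From HB Require Import structures.
From mathcomp Require Import all_boot all_order all_algebra.
From mathcomp Require Import complex reals ring.

Set Implicit Arguments.
Unset Strict Implicit.
Unset Printing Implicit Defensive.

Set Warnings "-redundant-canonical-projection".

Import Order.TTheory GRing.Theory Num.Theory.

Local Open Scope ring_scope.
Local Open Scope complex_scope.

(* R^q is 'cV[R]_q; a linear map of R^q is a matrix A acting by x |-> A *m x, *)
(* so that A *m B is the composition A o B.                                   *)

Section Curvature.
Variables (R : realType) (q : nat).
Local Notation V := 'cV[R]_q.

Definition dot (x y : V) : R := \sum_l x l 0 * y l 0.

Definition self_adjoint (A : 'M[R]_q) : Prop :=
  forall x y : V, dot (A *m x) y = dot x (A *m y).

Definition skew_adjoint (A : 'M[R]_q) : Prop :=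
  forall x y : V, dot (A *m x) y = - dot x (A *m y).

Definition isometry (A : 'M[R]_q) : Prop :=
  forall x y : V, dot (A *m x) (A *m y) = dot x y.

Definition tensor4 := V -> V -> V -> V -> R.

(* R_phi, for phi self-adjoint (curv_sa) and skew-adjoint (curv_sk).          *)
Definition curv_sa (phi : 'M[R]_q) : tensor4 := fun x y z w =>
  dot (phi *m y) z * dot (phi *m x) w - dot (phi *m x) z * dot (phi *m y) w.

Definition curv_sk (phi : 'M[R]_q) : tensor4 := fun x y z w =>
  dot (phi *m y) z * dot (phi *m x) w - dot (phi *m x) z * dot (phi *m y) w
  - 2 * dot (phi *m x) y * dot (phi *m z) w.

(* The standard basis is orthonormal, so for T linear in its last argument    *)
(* curv_op T x y z is the vector representing w |-> T x y z w; see            *)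
(* dot_curv_op below.                                                         *)
Definition curv_op (T : tensor4) (x y z : V) : V :=
  \col_l T x y z (delta_mx l 0).

(* R(pi) computed in the oriented basis {x, y} of pi. *)
Definition curv_plane (T : tensor4) (x y : V) : V -> V := fun z =>
  (Num.sqrt `|dot x x * dot y y - dot x y ^+ 2|)^-1 *: curv_op T x y z.

Definition same_orientation (x y u v : V) : Prop :=
  exists a b c d : R,
    [/\ x = a *: u + b *: v, y = c *: u + d *: v & 0 < a * d - b * c].

Lemma dotDr x y z : dot x (y + z) = dot x y + dot x z.
Proof.
by rewrite /dot -big_split; apply: eq_bigr => l _; rewrite mxE mulrDr.
Qed.

Lemma dotZr a x y : dot x (a *: y) = a * dot x y.
Proof. by rewrite /dot mulr_sumr; apply: eq_bigr => l _; rewrite mxE mulrCA. Qed.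

Lemma dotE (x y : V) : dot x y = (x^T *m y) 0 0.
Proof. by rewrite mxE; apply: eq_bigr => l _; rewrite mxE. Qed.

Lemma dot_curv_op (T : tensor4) x y z w :
  (forall a u v, T x y z (a *: u + v) = a * T x y z u + T x y z v) ->
  dot (curv_op T x y z) w = T x y z w.
Proof.
move=> linT.
have T0 : T x y z 0 = 0.
  by have := linT (-1) 0 0; rewrite scaler0 addr0 mulN1r addNr.
have TD u v : T x y z (u + v) = T x y z u + T x y z v.
  by rewrite -{1}[u]scale1r linT mul1r.
have TZ a u : T x y z (a *: u) = a * T x y z u.
  by rewrite -[a *: u]addr0 linT T0 addr0.
have {2}-> : w = \sum_l w l 0 *: delta_mx l 0.
  by rewrite [LHS]matrix_sum_delta; apply: eq_bigr => l _; rewrite big_ord1.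
rewrite (big_morph (T x y z) TD T0); apply: eq_bigr => l _.
by rewrite TZ mxE mulrC.
Qed.

Lemma dot_adj (A : 'M[R]_q) x y : dot (A *m x) y = dot x (A^T *m y).
Proof. by rewrite !dotE trmx_mul mulmxA. Qed.

End Curvature.

Section ComplexStructure.
Variables (R : realType) (q : nat).

Record complex_structure := ComplexStructure {
  cs_mx :> 'M[R]_q;
  cs_isometry : isometry cs_mx;
  cs_sqr : cs_mx *m cs_mx = - 1%:M
}.

(* R^q viewed as a complex vector space through sqrt(-1) x := J x. *)
Definition cspace (J : complex_structure) : Type := 'cV[R]_q.

Section CspaceInstances.
Variable J : complex_structure.

HB.instance Definition _ := GRing.Zmodule.copy (cspace J) 'cV[R]_q.

Definition cscale (z : R[i]) (x : cspace J) : cspace J :=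
  (complex.Re z *: (x : 'cV[R]_q) + complex.Im z *: (cs_mx J *m x) : 'cV[R]_q).

Fact cscaleA a b v : cscale a (cscale b v) = cscale (a * b) v.
Proof.
rewrite /cscale mulmxDr -!scalemxAr mulmxA cs_sqr mulNmx mul1mx.
apply/colP => l; move: (cs_mx J *m v) => w; rewrite !mxE.
by case: a b => [a1 a2] [b1 b2] /=; ring.
Qed.

Fact cscale1 : left_id 1 cscale.
Proof. by move=> v; rewrite /cscale /= scale1r scale0r addr0. Qed.

Fact cscaleDr : right_distributive cscale +%R.
Proof.
move=> a u v; rewrite /cscale mulmxDr; apply/colP => l.
by move: (_ *m u) (_ *m v) => u' v'; rewrite !mxE; ring.
Qed.

Fact cscaleDl v : {morph cscale^~ v : a b / a + b}.
Proof.
move=> a b; rewrite /cscale; apply/colP => l; move: (_ *m v) => w.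
by rewrite !mxE; case: a b => [a1 a2] [b1 b2] /=; ring.
Qed.

HB.instance Definition _ := GRing.Zmodule_isLmodule.Build R[i] (cspace J)
  cscaleA cscale1 cscaleDr cscaleDl.

(* v |-> v - sqrt(-1) J v is an isomorphism from (R^q, J) onto the            *)
(* sqrt(-1)-eigenspace of J in C^q, which makes cspace J finite dimensional.  *)
Let E := row_base (eigenspace (map_mx (real_complex R) J^T) 'i).
Let cx (v : 'cV[R]_q) : 'rV[R[i]]_q := map_mx (real_complex R) v^T.
Let psi (v : cspace J) : 'rV[R[i]]_q := cx v - 'i *: cx (cs_mx J *m v).
Let re (y : 'rV[R[i]]_q) : cspace J := \col_l complex.Re (y 0 l).

Let csK (v : 'cV[R]_q) : cs_mx J *m (cs_mx J *m v) = - v.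
Proof. by rewrite mulmxA cs_sqr mulNmx mul1mx. Qed.

Let cxJ v : cx v *m map_mx (real_complex R) J^T = cx (cs_mx J *m v).
Proof. by rewrite /cx -map_mxM trmx_mul. Qed.

Let psi_eigen v : (psi v <= E)%MS.
Proof.
rewrite eq_row_base; apply/eigenspaceP.
rewrite mulmxBl -scalemxAl !cxJ csK; apply/rowP => l.
by rewrite !mxE; simpc.
Qed.

Let psiK v : re (psi v) = v.
Proof. by apply/colP => l; rewrite !mxE; simpc. Qed.

Let reK y : (y <= E)%MS -> psi (re y) = y.
Proof.
rewrite eq_row_base => /eigenspaceP yE.
pose im : 'cV[R]_q := \col_l complex.Im (y 0 l).
have y_def : y = cx (re y) + 'i *: cx im.
  by apply/rowP => l; rewrite !mxE; simpc; case: (y 0 l).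
have Jre : cs_mx J *m re y = - im.
  apply/colP => l; move: yE; rewrite {1}y_def mulmxDl -scalemxAl !cxJ.
  move=> /rowP /(_ l); rewrite [_ *m re y]lock [_ *m im]lock !mxE -!lock.
  by case: (y 0 l) => a b; simpc => -[].
rewrite [RHS]y_def /psi Jre; apply/rowP => l.
by rewrite !mxE; simpc.
Qed.

Let psi_linear : linear psi.
Proof.
move=> [a b] u v; have -> : psi ((a +i* b) *: u + v) =
    cx (a *: u + b *: (cs_mx J *m u) + v) -
    'i *: cx (a *: (cs_mx J *m u) - b *: (u : 'cV[R]_q) + cs_mx J *m v).
  by rewrite /psi !mulmxDr -!scalemxAr csK scalerN.
rewrite /psi; move: (cs_mx J *m u) (cs_mx J *m v) => Ju Jv; apply/rowP => l.
by rewrite !mxE; simpc; congr (_ +i* _); ring.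
Qed.

Fact cspace_vect_iso : vector_axiom_def
  (\rank (eigenspace (map_mx (real_complex R) J^T) 'i)) (cspace J).
Proof.
exists (fun v => psi v *m pinvmx E).
  by move=> a u v; rewrite psi_linear mulmxDl scalemxAl.
exists (fun y => re (y *m E)) => [v | y]; first by rewrite mulmxKpV ?psiK.
by rewrite reK ?submxMl // mulmxKp ?row_base_free.
Qed.

HB.instance Definition _ :=
  Lmodule_hasFinDim.Build R[i] (cspace J) cspace_vect_iso.

End CspaceInstances.

(* A is complex linear, and its eigenvalues, with the complex dimensions of   *)
(* their eigenspaces, are those listed in spec; a listed value of dimension 0 *)
(* is not an eigenvalue.                                                      *)
Definition has_eigenvalues (J : complex_structure) (A : 'cV[R]_q -> 'cV[R]_q)
    (spec : seq (R * nat)) : Prop :=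
  exists f : 'End(cspace J),
    [/\ forall v : cspace J, f v = A v,
        forall p, p \in spec -> \dim (passmx.leigenspace f p.1%:C) = p.2
      & forall z : R[i], z \notin [seq p.1%:C | p <- spec] ->
          ~~ passmx.leigenvalue f z].

Definition complex_line (J : complex_structure) (pi : {vspace 'cV[R]_q}) :
    Prop :=
  \dim pi = 2%N /\ (linfun (mulmx J) @: pi)%VS = pi.

(* {x, y} is a basis of the complex line pi, positive for the orientation     *)
(* given by the bases {u, J u}.                                               *)
Definition oriented_basis (J : complex_structure) (pi : {vspace 'cV[R]_q})
    (x y : 'cV[R]_q) : Prop :=
  basis_of pi [:: x; y] /\
  exists2 u : 'cV[R]_q,
    basis_of pi [:: u; J *m u] & same_orientation x y u (J *m u).

(* J R(pi), for pi oriented by the basis {x, y}. *)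
Definition JR (J : complex_structure) (T : tensor4 R q) (x y : 'cV[R]_q) :
    'cV[R]_q -> 'cV[R]_q :=
  fun z => J *m curv_plane T x y z.

Definition quaternion_structure (I J K : 'M[R]_q) : Prop :=
  [/\ [/\ skew_adjoint I, skew_adjoint J & skew_adjoint K],
      [/\ I *m I = - 1%:M, J *m J = - 1%:M & K *m K = - 1%:M]
    & [/\ I *m J = K /\ J *m I = - K, J *m K = I /\ K *m J = - I
        & K *m I = J /\ I *m K = - J]].

Lemma skew_trmx (A : 'M[R]_q) : A^T = - A -> skew_adjoint A.
Proof.
by move=> AT x y; rewrite dot_adj AT mulNmx -scaleN1r dotZr mulN1r.
Qed.

Lemma self_adjoint1 : self_adjoint (1%:M : 'M[R]_q).
Proof. by move=> x y; rewrite !mul1mx. Qed.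

Lemma isometry_trmx (A : 'M[R]_q) : A^T *m A = 1%:M -> isometry A.
Proof. by move=> AT x y; rewrite dot_adj mulmxA AT mul1mx. Qed.

End ComplexStructure.

Section UsualStructures.
Variables (R : realType) (s : nat).

(* R^(s + s) = C^s, the column (x, y) being the vector x + sqrt(-1) y.        *)
Definition usual_mx : 'M[R]_(s + s) := block_mx 0 (- 1%:M) 1%:M 0.

Lemma usual_mx_tr : usual_mx^T = - usual_mx.
Proof.
by rewrite tr_block_mx opp_block_mx !linearN /= !trmx0 !trmx1 !oppr0 opprK.
Qed.

Lemma usual_mx_sqr : usual_mx *m usual_mx = - 1%:M.
Proof.
rewrite mulmx_block !mul0mx !mulmx0 !mulmx1 !mul1mx !add0r !addr0.
by rewrite scalar_mx_block opp_block_mx !oppr0.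
Qed.

Lemma usual_mx_isometry : isometry usual_mx.
Proof.
by apply: isometry_trmx; rewrite usual_mx_tr mulNmx usual_mx_sqr opprK.
Qed.

Lemma usual_mx_skew_adjoint : skew_adjoint usual_mx.
Proof. exact/skew_trmx/usual_mx_tr. Qed.

Definition usual_complex : complex_structure R (s + s) :=
  ComplexStructure usual_mx_isometry usual_mx_sqr.

(* R^(4 s) = H^s, the column (x0, x1, x2, x3) being the vector                *)
(* x0 + i x1 + j x2 + k x3; the maps below are the left multiplications by    *)
(* i, j, k:                                                                   *)
(*   i (x0, x1, x2, x3) = (- x1,   x0, - x3,   x2)                            *)
(*   j (x0, x1, x2, x3) = (- x2,   x3,   x0, - x1)                            *)
(*   k (x0, x1, x2, x3) = (- x3, - x2,   x1,   x0)                            *)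
Definition quat_i : 'M[R]_(s + s + (s + s)) := block_mx usual_mx 0 0 usual_mx.

Definition quat_j : 'M[R]_(s + s + (s + s)) :=
  let D : 'M[R]_(s + s) := block_mx 1%:M 0 0 (- 1%:M) in block_mx 0 (- D) D 0.

Definition quat_k : 'M[R]_(s + s + (s + s)) :=
  let S : 'M[R]_(s + s) := block_mx 0 1%:M 1%:M 0 in block_mx 0 (- S) S 0.

Local Ltac quat_simp := rewrite ?(tr_block_mx, linearN, trmx0, trmx1) /=
  ?(mulmx_block, opp_block_mx, add_block_mx, scalar_mx_block, mulmxN, mulNmx,
    mul0mx, mulmx0, mulmx1, mul1mx, add0r, addr0, oppr0, opprK, tr_block_mx,
    trmx0, trmx1).

Lemma quat_structure : quaternion_structure quat_i quat_j quat_k.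
Proof.
rewrite /quat_i /quat_j /quat_k /usual_mx; split; split.
all: try apply: skew_trmx.
all: try split.
all: repeat quat_simp; rewrite ?linearN /= ?trmx1.
all: by [].
Qed.

Lemma quat_i_sqr : quat_i *m quat_i = - 1%:M.
Proof. by case: quat_structure => _ []. Qed.

Lemma quat_i_isometry : isometry quat_i.
Proof.
apply: isometry_trmx; rewrite tr_block_mx usual_mx_tr !trmx0.
by rewrite -[X in block_mx _ X]oppr0 -[X in block_mx _ _ X]oppr0
  -opp_block_mx mulNmx quat_i_sqr opprK.
Qed.

Definition quat_complex : complex_structure R (s + s + (s + s)) :=
  ComplexStructure quat_i_isometry quat_i_sqr.

End UsualStructures.

(* Main.v *)
(* If u is a unit vector of the complex line pi, write P_v for the orthogonal
   projection onto the complex line of v. Then J R(pi) is P_u for R_Id,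
   2 + P_u for R_J, and - P_(phi u) for R_phi when phi is skew-adjoint and
   anticommutes with J. Since phi u is orthogonal to the line of u, the operator
   J R(pi) of c0 R_Id + c1 R_J + c2 R_phi is
   2 c1 + (c0 + c1) P_u - c2 P_(phi u), a scalar plus a combination of
   projections onto orthogonal complex lines, whose eigenvalues 2 c1,
   c0 + 3 c1 and 2 c1 - c2 are prescribed at will. For the quaternion structure
   phi = j suffices, and c3 = 0. *)

Require Import Defs.
From HB Require Import structures.
From mathcomp Require Import all_boot all_order all_algebra.
From mathcomp Require Import complex reals ring.

Import Order.TTheory GRing.Theory Num.Theory.
Local Open Scope ring_scope.

(** * Eigenspaces of a scalar plus a finite-rank operator *)

Section DualSystem.
Variables (F : fieldType) (vT : vectType F) (k : nat).
Variables (e : 'I_k -> vT) (h : 'I_k -> {scalar vT}).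
Hypothesis dual : forall i j, h i (e j) = (i == j)%:R.

Definition dual_coord (v : vT) : 'rV[F]_k := \row_j h j v.

Fact dual_coord_linear : linear dual_coord.
Proof. by move=> a u v; apply/rowP => j; rewrite !mxE linearP. Qed.

HB.instance Definition _ :=
  GRing.isLinear.Build F vT 'rV[F]_k _ dual_coord dual_coord_linear.

Lemma dual_sum j (c : 'I_k -> F) : h j (\sum_i c i *: e i) = c j.
Proof.
rewrite linear_sum (bigD1 j) //= linearZ /= dual eqxx mulr1.
rewrite big1 ?addr0 // => i ij; rewrite linearZ /= dual eq_sym (negPf ij).
exact: mulr0.
Qed.

Lemma dim_lker_dual_coord : \dim (lker (linfun dual_coord)) = (dim vT - k)%N.
Proof.
have surj : limg (linfun dual_coord) = fullv.
  apply/vspaceP => r; rewrite memvf; apply/memv_imgP.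
  exists (\sum_i r 0 i *: e i); first exact: memvf.
  by apply/rowP => j; rewrite lfunE mxE dual_sum.
have := limg_ker_dim (linfun dual_coord) fullv.
by rewrite capfv surj !dimvf /dim /= mul1n => <-; rewrite addnK.
Qed.

Lemma dual_free (A : pred 'I_k) : free [seq e j | j <- enum A].
Proof.
have fe : free [seq e j | j <- enum 'I_k].
  have -> : [seq e j | j <- enum 'I_k] = [tuple e i | i < k] by [].
  apply/freeP => c c0 i; move: (congr1 (h i) c0).
  under eq_bigr do rewrite -tnth_nth tnth_mktuple.
  by rewrite dual_sum linear0.
(* The subfamily splits off the full free family once the enumeration is permuted into [A] followed
   by its complement. *)
have : perm_eq [seq e j | j <- enum 'I_k]
   ([seq e j | j <- enum A] ++ [seq e j | j <- enum [predC A]]).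
  rewrite -map_cat perm_map // perm_sym /enum_mem.
  rewrite [X in _ ++ X](eq_filter (a2 := predC (mem A))) //.
  by rewrite filter_predT; apply/permPl/perm_filterC.
by move/perm_free => fE; move: fe; rewrite fE => /catl_free.
Qed.

Variables (a : F) (mu : 'I_k -> F) (f : 'End(vT)).
Hypothesis mu_neq : forall j, mu j != a.
Hypothesis fE : forall v, f v = a *: v + \sum_j ((mu j - a) * h j v) *: e j.

Lemma memv_leigenspace z v :
  (v \in passmx.leigenspace f z) = (f v == z *: v).
Proof.
by rewrite memv_ker add_lfunE opp_lfunE scale_lfunE id_lfunE subr_eq0.
Qed.

Lemma dual_coord_fE j v : h j (f v) = mu j * h j v.
Proof.
by rewrite fE linearD linearZ /= dual_sum; ring.
Qed.

(** Applying [h j] to [f v = a *: v] forces [h j v = 0] because [mu j != a], so the eigenspace is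
    the common kernel of the [h j]. *)
Lemma dim_leigenspace_base : \dim (passmx.leigenspace f a) = (dim vT - k)%N.
Proof.
rewrite -dim_lker_dual_coord; congr (\dim _); apply/vspaceP => v.
rewrite memv_leigenspace memv_ker lfunE /=.
apply/eqP/eqP => [fv | /rowP hv0].
  apply/rowP => j; rewrite !mxE; apply/eqP.
  have /eqP := dual_coord_fE j v.
  rewrite fv linearZ /= eq_sym -subr_eq0 -mulrBl.
  by rewrite mulf_eq0 subr_eq0 (negPf (mu_neq j)).
rewrite fE big1 ?addr0 // => j _; have := hv0 j; rewrite !mxE => ->.
by rewrite mulr0 scale0r.
Qed.

(** As [z != a], the equation [f v = z *: v] can be solved for [v] as a combination of the [e j],
    and the coefficients with [mu j != z] vanish. A [z] that is neither [a] nor any [mu j] gets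
    dimension 0, which later rules out further eigenvalues. *)
Lemma dim_leigenspace_dual z : z != a ->
  \dim (passmx.leigenspace f z) = #|[pred j | mu j == z]|.
Proof.
move=> za; set A := [pred j | _].
suff -> : passmx.leigenspace f z = <<[seq e j | j <- enum A]>>%VS.
  by have /eqP -> := dual_free A; rewrite size_map -cardE.
apply/eqP; rewrite eqEsubv; apply/andP; split; last first.
  apply/span_subvP => _ /mapP [j + ->]; rewrite mem_enum => /eqP <-.
  rewrite memv_leigenspace fE (bigD1 j) //= big1 => [|i ij].
    by rewrite dual eqxx mulr1 addr0 -scalerDl addrC subrK.
  by rewrite dual (negPf ij) mulr0 scale0r.
apply/subvP => v; rewrite memv_leigenspace => /eqP fv.
have -> : v = \sum_j (((mu j - a) * h j v) / (z - a)) *: e j.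
  have za0 : z - a != 0 by rewrite subr_eq0.
  apply: (scalerI za0); rewrite scalerBl -fv fE addrAC subrr add0r scaler_sumr.
  by apply: eq_bigr => j _; rewrite scalerA mulrCA divff ?mulr1.
apply: memv_suml => j _; have [jz | jz] := eqVneq (mu j) z.
  apply/memvZ/memv_span/map_f; rewrite mem_enum inE; exact/eqP.
have /eqP := dual_coord_fE j v.
rewrite fv linearZ /= eq_sym -subr_eq0 -mulrBl mulf_eq0 subr_eq0 (negPf jz) /=.
by move=> /eqP ->; rewrite mulr0 mul0r scale0r mem0v.
Qed.

End DualSystem.

Arguments dim_leigenspace_base {F vT k e h} dual {a mu f}.
Arguments dim_leigenspace_dual {F vT k e h} dual {a mu f}.

(** * The Hermitian form and the complex dimension *)

Section HermitianForm.
Variables (R : realType) (q : nat).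
Local Notation V := 'cV[R]_q.
Implicit Types x y z : V.

Lemma dotC x y : dot x y = dot y x.
Proof. by rewrite /dot; apply: eq_bigr => l _; rewrite mulrC. Qed.

Lemma dotDl x y z : dot (x + y) z = dot x z + dot y z.
Proof. by rewrite ![dot _ z]dotC dotDr. Qed.

Lemma dotZl a x y : dot (a *: x) y = a * dot x y.
Proof. by rewrite ![dot _ y]dotC dotZr. Qed.

Lemma dotNr x y : dot x (- y) = - dot x y.
Proof. by rewrite -scaleN1r dotZr mulN1r. Qed.

Lemma dotNl x y : dot (- x) y = - dot x y.
Proof. by rewrite -scaleN1r dotZl mulN1r. Qed.

Lemma dot_delta x l : dot x (delta_mx l 0) = x l 0.
Proof.
rewrite /dot (bigD1 l) //= !mxE !eqxx mulr1 big1 ?addr0 // => i il.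
by rewrite mxE (negPf il) mulr0.
Qed.

Lemma dot_ge0 x : 0 <= dot x x.
Proof. by apply: sumr_ge0 => l _; rewrite -expr2 sqr_ge0. Qed.

Lemma dot_eq0 x : (dot x x == 0) = (x == 0).
Proof.
apply/idP/eqP => [|->]; last by rewrite dotE trmx0 mul0mx mxE.
rewrite psumr_eq0 => [/allP x0|l _]; last by rewrite -expr2 sqr_ge0.
apply/colP => l; rewrite mxE; apply/eqP; rewrite -sqrf_eq0 expr2.
by have := x0 l (mem_index_enum l).
Qed.

Lemma skew_dot0 (phi : 'M[R]_q) x : skew_adjoint phi -> dot (phi *m x) x = 0.
Proof.
move=> sk; apply/eqP; rewrite -[_ == 0](mulrn_eq0 _ 2) mulr2n.
by rewrite {1}sk dotC addNr.
Qed.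

Variable J : complex_structure R q.

Lemma cs_mxK x : J *m (J *m x) = - x.
Proof. by rewrite mulmxA cs_sqr mulNmx mul1mx. Qed.

Lemma cs_skew : skew_adjoint J.
Proof.
by move=> x y; rewrite -[in RHS](cs_isometry J) cs_mxK dotNr opprK.
Qed.

(* The projection onto the complex line of u only if u is a unit vector. *)
Definition line_proj u z : 'cV[R]_q :=
  dot u z *: u + dot (J *m u) z *: (J *m u).

(* Antilinear in u and linear in v. *)
Definition herm (u v : cspace J) : R[i] := (dot u v +i* dot (J *m u) v)%C.

Fact herm_scalar u : scalar (herm u).
Proof.
move=> [a b] v w; rewrite /herm.
have -> : (a +i* b)%C *: v + w = (a *: v + b *: (J *m v) + w : V) by [].
(* Turning [dot u (J *m v)] into [- dot (J *m u) v] leaves the formula for a product of complex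
   numbers. *)
rewrite !(dotDr, dotZr) cs_isometry -[dot u (J *m v)]opprK -cs_skew.
by apply/eqP; rewrite eq_complex /=; apply/andP; split; apply/eqP; ring.
Qed.

HB.instance Definition _ u :=
  GRing.isLinear.Build R[i] (cspace J) R[i] _ (herm u) (herm_scalar u).

Lemma herm_unit (u : V) : dot u u = 1 -> herm u u = 1.
Proof.
move=> uu; apply/eqP; rewrite eq_complex /= uu skew_dot0 ?eqxx //.
exact: cs_skew.
Qed.

(* (A - i)(A + i) = 0 and (A + i) - (A - i) = 2i, while A - i and A + i are
   conjugate, so that both have rank q / 2. *)
Lemma dim_cspace : (dim (cspace J)).*2 = q.
Proof.
pose A := map_mx (real_complex R) J^T; pose c : R[i] := 'i%C.
have -> : dim (cspace J) = \rank (eigenspace A c) by [].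
have A2 : A *m A = - 1%:M.
  by rewrite -map_mxM -trmx_mul cs_sqr linearN /= trmx1 map_mxN map_mx1.
have cc : c * c = -1 by rewrite -expr2 sqr_i.
have rC : \rank (A + c%:M)%R = \rank (A - c%:M)%R.
  rewrite -(mxrank_map (@conjc R)) map_mxD map_scalar_mx -map_mx_comp.
  congr (\rank (_ + _)%R).
    by apply/matrixP => i j; rewrite !mxE /= oppr0.
  by rewrite -raddfN; congr _%:M; apply/eqP; rewrite eq_complex /= oppr0
    !eqxx.
have prod0 : (A - c%:M) *m (A + c%:M) = 0.
  rewrite mulmxBl !mulmxDr A2 -scalar_mxM cc scalar_mxC raddfN /= opprD opprK.
  by rewrite [X in _ + X = _]addrC addrACA addNr add0r addrN.
have le := mulmx0_rank_max prod0.
have rkB : \rank ((A + c%:M) - (A - c%:M))%R = q.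
  have -> : (A + c%:M) - (A - c%:M) = (2 * c) *: 1%:M.
    rewrite opprD opprK addrACA subrr add0r -[c%:M]scalemx1 -scalerDl.
    by rewrite mulr_natl mulr2n.
  rewrite mxrank_scale_nz ?mxrank1 //.
  by rewrite mulf_neq0 ?pnatr_eq0 // eq_complex /= oner_eq0 andbF.
have := mxrank_add (A + c%:M)%R (- (A - c%:M))%R.
rewrite rkB mxrank_opp rC addnn => ge.
rewrite rC addnn in le.
rewrite mxrank_ker doubleB; move: le ge; case: ltngtP => // -> _ _.
by rewrite -addnn addnK.
Qed.

End HermitianForm.

Arguments herm {R q} J u v.
Arguments line_proj {R q} J u z.

(** * Complex spectrum of a real operator given by a unitary system *)

Section UnitarySystem.
Variables (R : realType) (q : nat) (J : complex_structure R q) (k : nat).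
Variables (e : 'I_k -> 'cV[R]_q) (a : R) (mu : 'I_k -> R).

Definition rank_update (v : cspace J) : cspace J :=
  (a%:C)%C *: v
  + \sum_j (((mu j)%:C - a%:C)%C * herm J (e j) v) *: (e j : cspace J).

Fact rank_update_linear : linear rank_update.
Proof.
move=> b u v.
rewrite /rank_update [in RHS]scalerDr [in RHS]addrACA [in RHS]scaler_sumr.
rewrite -big_split [in LHS]scalerDr !scalerA [b * _]mulrC.
congr (_ + _); apply: eq_bigr => j _.
by rewrite /= scalerA -scalerDl linearP /= mulrDr; congr ((_ + _) *: _); ring.
Qed.

HB.instance Definition _ := GRing.isLinear.Build R[i] (cspace J) (cspace J) _
  rank_update rank_update_linear.

(** The factors [mu j - a] are real and sqrt(-1) acts as [J], so the complex multiple
    [herm J (e j) v] of [e j] unfolds to [line_proj]. *)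
Lemma rank_updateE (v : 'cV[R]_q) : rank_update v = a *: v
  + \sum_j (mu j - a) *: line_proj J (e j) v :> 'cV[R]_q.
Proof.
have scaleE (b c : R) (w : cspace J) :
  (b +i* c)%C *: w = b *: (w : 'cV[R]_q) + c *: (J *m w) :> 'cV[R]_q by [].
rewrite /rank_update scaleE scale0r addr0; congr (_ + _).
apply: eq_bigr => j _; rewrite -raddfB /herm /=.
have -> : ((mu j - a)%:C * (dot (e j) v +i* dot (J *m e j) v) =
  ((mu j - a) * dot (e j) v) +i* ((mu j - a) * dot (J *m e j) v))%C.
  by simpc.
by rewrite scaleE scalerDr !scalerA.
Qed.

Hypothesis herm_e : forall i j, herm J (e i) (e j) = (i == j)%:R.
Hypothesis mu_neq : forall j, mu j != a.

(** Unitarity makes the forms [herm J (e j)] dual to the [e j], so the dimension counts for dual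
    systems apply. The [mu j] may coincide, and [q./2] is the complex dimension of the space. *)
Lemma has_eigenvalues_unitary (A : 'cV[R]_q -> 'cV[R]_q)
    (spec : seq (R * nat)) :
  (forall v, A v = a *: v + \sum_j (mu j - a) *: line_proj J (e j) v) ->
  a \in [seq p.1 | p <- spec] -> (forall j, mu j \in [seq p.1 | p <- spec]) ->
  (forall p, p \in spec ->
     p.2 = if p.1 == a then (q./2 - k)%N else #|[pred j | mu j == p.1]|) ->
  has_eigenvalues J A spec.
Proof.
move=> AE a_spec mu_spec dim_spec; exists (linfun rank_update).
pose h j : {scalar cspace J} := herm J (e j).
pose muC j := ((mu j)%:C)%C; pose aC := (a%:C)%C.
have muC_neq j : muC j != aC.
  by rewrite (inj_eq (@complexI _)) mu_neq.
have fE v : linfun rank_update v =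
    aC *: v + \sum_j ((muC j - aC) * h j v) *: (e j : cspace J).
  by rewrite lfunE.
have dual i j : h i (e j) = (i == j)%:R by apply: herm_e.
split=> [v | p p_spec | z z_spec].
- by rewrite lfunE AE -rank_updateE.
- rewrite (dim_spec p p_spec); have [-> | pa] := eqVneq p.1 a.
    rewrite (dim_leigenspace_base dual muC_neq fE).
    by rewrite -[in RHS](dim_cspace _ _ J) doubleK.
  rewrite (dim_leigenspace_dual dual fE).
    by apply: eq_card => j; rewrite !inE (inj_eq (@complexI _)).
  by rewrite (inj_eq (@complexI _)).
(* An unlisted value differs from [a] and from every [mu j], so its eigenspace is zero. *)
- have z_neq b : b \in [seq p.1 | p <- spec] -> z != (b%:C)%C.
    move=> /mapP[p p_spec ->]; apply: contraNneq z_spec => ->.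
    by apply/mapP; exists p.
  rewrite negbK -dimv_eq0 (dim_leigenspace_dual dual fE) ?z_neq //=.
  by apply/eqP/eq_card0 => j; rewrite !inE eq_sym;
    exact: negPf (z_neq _ (mu_spec j)).
Qed.

End UnitarySystem.

(** * Curvature operators of oriented planes *)

Section CurvatureOperator.
Variables (R : realType) (q : nat).
Local Notation V := 'cV[R]_q.
Implicit Types (T : tensor4 R q) (x y z u v : V).

(* T(x, y) depends on x and y only through their wedge product. *)
Definition area_form T := forall a b c d u v z w,
  T (a *: u + b *: v) (c *: u + d *: v) z w = (a * d - b * c) * T u v z w.

Lemma area_form_sa phi : area_form (curv_sa phi).
Proof.
move=> a b c d u v z w; rewrite /curv_sa !mulmxDr -!scalemxAr !(dotDl, dotZl).
ring.
Qed.

(** Skewness makes [dot (phi *m x) y] alternating in [x] and [y], which handles the third term. *)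
Lemma area_form_sk phi : skew_adjoint phi -> area_form (curv_sk phi).
Proof.
move=> sk a b c d u v z w; rewrite /curv_sk !mulmxDr -!scalemxAr.
rewrite !(dotDl, dotZl, dotDr, dotZr).
have skC x y : dot (phi *m x) y = - dot (phi *m y) x.
  by rewrite sk dotC.
by rewrite !(skew_dot0 _ _ _ _ sk) (skC v u); ring.
Qed.

Lemma area_formD c T c' T' : area_form T -> area_form T' ->
  area_form (fun x y z w => c * T x y z w + c' * T' x y z w).
Proof. by move=> aT aT' a b d e u v z w; rewrite aT aT'; ring. Qed.

(** A change of basis of determinant [D > 0] multiplies both the curvature and the root of the Gram
    determinant by [D], so the normalised operator can be computed in the orthonormal basis [u],
    [J *m u]. *)
Lemma oriented_basis_unit (J : complex_structure R q) pi x y :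
  oriented_basis J pi x y ->
  exists2 u, dot u u = 1 &
    forall T, area_form T -> curv_plane T x y =1 curv_op T u (J *m u).
Proof.
case=> _ [v v_basis [a [b [c [d [-> -> D0]]]]]].
have v0 : v != 0 by exact: basis_not0 v_basis (mem_head _ _).
pose r := Num.sqrt (dot v v).
have r2 : r * r = dot v v by rewrite -expr2 sqr_sqrtr ?dot_ge0.
have r0 : r != 0 by rewrite -sqrf_eq0 expr2 r2 dot_eq0.
have [u vE uu] : exists2 u, v = r *: u & dot u u = 1.
  exists (r^-1 *: v); first by rewrite scalerA divff ?scale1r.
  by rewrite dotZl dotZr -r2; field.
exists u => // T aT z; rewrite {}vE -scalemxAr !scalerA.
(* Determinant of the passage from [u], [J *m u] to the given basis; normalising [v] contributes
   [r ^+ 2]. *)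
set D := (a * r) * (d * r) - (b * r) * (c * r).
have Dgt0 : 0 < D.
  have -> : D = (a * d - b * c) * r ^+ 2 by rewrite /D; ring.
  by rewrite mulr_gt0 // exprn_even_gt0.
have uJ : dot u (J *m u) = 0 by rewrite dotC skew_dot0 //; apply: cs_skew.
have JJ : dot (J *m u) (J *m u) = 1 by rewrite cs_isometry.
rewrite /curv_plane !(dotDl, dotDr, dotZl, dotZr) [dot (J *m u) u]dotC uJ uu JJ.
rewrite [X in `|X|](_ : _ = D ^+ 2); last by rewrite /D; ring.
rewrite normrX sqrtr_sqr normr_id gtr0_norm //.
apply/colP => l; rewrite !mxE aT -/D mulrA mulVf ?mul1r //.
by rewrite gt_eqF.
Qed.

Lemma curv_opD c T c' T' x y z :
  curv_op (fun x y z w => c * T x y z w + c' * T' x y z w) x y z =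
  c *: curv_op T x y z + c' *: curv_op T' x y z.
Proof. by apply/colP => l; rewrite !mxE. Qed.

Lemma curv_op_sa phi x y z : curv_op (curv_sa phi) x y z =
  dot (phi *m y) z *: (phi *m x) - dot (phi *m x) z *: (phi *m y).
Proof.
apply/colP => l; rewrite mxE /curv_sa !dot_delta.
by rewrite [_ *m x]lock [_ *m y]lock !mxE.
Qed.

Lemma curv_op_sk phi x y z : curv_op (curv_sk phi) x y z =
  dot (phi *m y) z *: (phi *m x) - dot (phi *m x) z *: (phi *m y)
  - (2 * dot (phi *m x) y) *: (phi *m z).
Proof.
apply/colP => l; rewrite mxE /curv_sk !dot_delta.
by rewrite [_ *m x]lock [_ *m y]lock [_ *m z]lock !mxE.
Qed.

End CurvatureOperator.

Arguments area_form {R q} T.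
Arguments oriented_basis_unit {R q J pi x y}.
Arguments has_eigenvalues_unitary {R q J k e a mu}.

(** * J R(pi) for the basic tensors *)

Section HolomorphicCurvature.
Variables (R : realType) (q : nat) (J : complex_structure R q).
Local Notation V := 'cV[R]_q.
Implicit Types u v z : V.

Lemma JR_sa1 u z : J *m curv_op (curv_sa 1%:M) u (J *m u) z = line_proj J u z.
Proof.
rewrite curv_op_sa !mul1mx mulmxDr mulmxN -!scalemxAr cs_mxK scalerN opprK.
by rewrite addrC.
Qed.

(** As [J] sends [u], [J *m u] to [J *m u], [- u], the first two terms contribute the same as for
    the identity. The third is [- 2 *: (J *m z)], which [J] turns into [2 *: z]. *)
Lemma JR_sk_self u z : dot u u = 1 ->
  J *m curv_op (curv_sk J) u (J *m u) z = 2 *: z + line_proj J u z.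
Proof.
move=> uu; rewrite curv_op_sk cs_isometry uu mulr1 cs_mxK !mulmxDr !mulmxN.
rewrite -!scalemxAr mulmxN !cs_mxK dotNl scaleNr !scalerN !opprK addrC.
by congr (_ + _); rewrite /line_proj.
Qed.

(** By anticommutation [phi *m J] is again skew-adjoint, so this product equals its own opposite. *)
Lemma anti_dot0 (phi : 'M[R]_q) u :
  skew_adjoint phi -> phi *m J = - (J *m phi) ->
  dot (phi *m u) (J *m u) = 0.
Proof.
move=> sk anti; apply/eqP; rewrite -[_ == 0](mulrn_eq0 _ 2) mulr2n.
rewrite {1}sk mulmxA anti mulNmx dotNr opprK -mulmxA dotC cs_skew.
by rewrite addNr.
Qed.

(** The third term vanishes by [anti_dot0]. In the others, [u], [J *m u] goes to [phi *m u],
    [- (J *m (phi *m u))], and this reversed orientation gives the minus sign. *)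
Lemma JR_sk_anti (phi : 'M[R]_q) u z :
  skew_adjoint phi -> phi *m J = - (J *m phi) ->
  J *m curv_op (curv_sk phi) u (J *m u) z = - line_proj J (phi *m u) z.
Proof.
move=> sk anti; rewrite curv_op_sk mulmxA anti mulNmx -mulmxA.
rewrite anti_dot0 // mulr0 scale0r subr0 mulmxDr mulmxN -!scalemxAr mulmxN.
by rewrite cs_mxK dotNl opprK scaleNr -opprD addrC.
Qed.

End HolomorphicCurvature.

(** * Choice of the constants *)

(** The constants solve [2 * c1 = lam0] and [c0 + c1 = lam1 - lam0]. *)
Lemma has_eigenvalues_complex_space_form (R : realType) (s : nat)
    (lam0 lam1 : R) :
  lam0 != lam1 ->
  let J := usual_complex R s in
  let T : tensor4 R (s + s) := fun x y z w =>
    (lam1 - 3 / 2 * lam0) * curv_sa 1%:M x y z w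
    + lam0 / 2 * curv_sk J x y z w in
  forall (pi : {vspace 'cV[R]_(s + s)}) (x y : 'cV[R]_(s + s)),
    oriented_basis J pi x y ->
    has_eigenvalues J (JR J T x y) [:: (lam0, (s - 1)%N); (lam1, 1%N)].
Proof.
move=> h01 J T pi x y pi_xy.
have T_area : area_form T.
  by apply: area_formD; [exact: area_form_sa | exact/area_form_sk/cs_skew].
have [u uu curvE] := oriented_basis_unit pi_xy.
apply: (has_eigenvalues_unitary (e := fun _ : 'I_1 => u) (a := lam0)
  (mu := fun=> lam1)) => [i j | _ | v | | _ | p].
- by rewrite !ord1 eqxx herm_unit.
- by rewrite eq_sym.
- rewrite /JR curvE // curv_opD mulmxDr -!scalemxAr JR_sa1 JR_sk_self //.
  rewrite big_ord1; move: (line_proj J u v) => P.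
  by apply/colP => l; rewrite !mxE; field.
- by rewrite inE eqxx.
- by rewrite !inE eqxx orbT.
- rewrite !inE => /orP[] /eqP -> /=; first by rewrite eqxx addnn doubleK.
  rewrite eq_sym (negPf h01) -[RHS]sum1_card big_mkcond big_ord1 inE /=.
  by rewrite eqxx.
Qed.

(** Serves both quaternionic cases: [mu1] and [mu2] belong to the complex lines of [u] and
    [quat_j R s *m u], and may be equal. Besides [2 * c1 = lam0] and [c0 + c1 = mu1 - lam0], the
    sign in [JR_sk_anti] demands [- c2 = mu2 - lam0]. *)
Lemma has_eigenvalues_quaternionic (R : realType) (s : nat) (lam0 mu1 mu2 : R)
    (spec : seq (R * nat)) :
  mu1 != lam0 -> mu2 != lam0 ->
  lam0 \in [seq p.1 | p <- spec] -> mu1 \in [seq p.1 | p <- spec] ->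
  mu2 \in [seq p.1 | p <- spec] ->
  (forall p, p \in spec -> p.2 = if p.1 == lam0 then (2 * s - 2)%N
                               else ((mu1 == p.1) + (mu2 == p.1))%N) ->
  let J := quat_complex R s in
  let T : tensor4 R (s + s + (s + s)) := fun x y z w =>
    (mu1 - 3 / 2 * lam0) * curv_sa 1%:M x y z w
    + lam0 / 2 * curv_sk (quat_i R s) x y z w
    + (lam0 - mu2) * curv_sk (quat_j R s) x y z w
    + 0 * curv_sk (quat_k R s) x y z w in
  forall (pi : {vspace 'cV[R]_(s + s + (s + s))})
      (x y : 'cV[R]_(s + s + (s + s))),
    oriented_basis J pi x y -> has_eigenvalues J (JR J T x y) spec.
Proof.
move=> h1 h2 spec0 spec1 spec2 specE J T pi x y pi_xy.
have [[_ j_sk _] [_ jj _] [[ij ji] _ _]] := quat_structure R s.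
have anti : quat_j R s *m J = - (J *m quat_j R s) by rewrite ji ij.
(* Nested two-term combinations, the shape that [area_formD] and [curv_opD] accept. *)
pose T' x y z w := 1 * ((mu1 - 3 / 2 * lam0) * curv_sa 1%:M x y z w
  + lam0 / 2 * curv_sk J x y z w) + (lam0 - mu2) * curv_sk (quat_j R s) x y z w.
have T_area : area_form T'.
  apply: area_formD; last exact: area_form_sk.
  by apply: area_formD; [exact: area_form_sa | exact/area_form_sk/cs_skew].
have TE z : JR J T x y z = JR J T' x y z.
  rewrite /JR /curv_plane; congr (_ *m (_ *: _)).
  by apply/colP => l; rewrite !mxE /T /T' mul0r addr0 mul1r.
have [u uu curvE] := oriented_basis_unit pi_xy.
pose e (i : 'I_2) := if i == 0 then u else quat_j R s *m u.
pose mu (i : 'I_2) := if i == 0 then mu1 else mu2.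
have ju_J : dot (quat_j R s *m u) (J *m u) = 0 by apply: anti_dot0.
have juju : dot (quat_j R s *m u) (quat_j R s *m u) = 1.
  by rewrite j_sk mulmxA jj mulNmx mul1mx dotNr opprK.
apply: (has_eigenvalues_unitary (e := e) (a := lam0)
  (mu := mu)) => [i j | i | v | | i | p p_spec].
(* The real part vanishes by skewness of [quat_j], the imaginary part by [anti_dot0]. *)
- have uju : herm J u (quat_j R s *m u) = 0.
    by apply/eqP; rewrite eq_complex /= dotC skew_dot0 // dotC ju_J !eqxx.
  have juu : herm J (quat_j R s *m u) u = 0.
    apply/eqP; rewrite eq_complex /= skew_dot0 // (cs_skew _ _ J) ju_J oppr0.
    by rewrite !eqxx.
  case: i => [[|[|//]] ?]; case: j => [[|[|//]] ?]; rewrite /e /=;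
    by rewrite ?uju ?juu ?herm_unit.
- by rewrite /mu; case: ifP.
- rewrite TE /JR curvE // !curv_opD scale1r !mulmxDr -!scalemxAr.
  rewrite JR_sa1 JR_sk_self // JR_sk_anti // !big_ord_recl big_ord0 addr0 /=.
  rewrite /e /mu /=; move: (line_proj J u v) (line_proj J _ v) => P Q.
  by apply/colP => l; rewrite !mxE; field.
- by [].
- by rewrite /mu; case: ifP.
- rewrite (specE p p_spec); case: ifP => _.
    by rewrite [in RHS]addnn doubleK addnn mul2n.
  rewrite -[RHS]sum1_card big_mkcond !big_ord_recl big_ord0 Monoid.mulm1.
  by rewrite !inE /mu /=; case: (mu1 == _); case: (mu2 == _).
Qed.

Theorem theorem9 (R : realType) (lam0 lam1 lam2 : R) (s : nat)
    (h01 : lam0 != lam1) (h02 : lam0 != lam2) (h12 : lam1 != lam2)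
    (hs : (1 <= s)%N) :
  (exists c0 c1 : R,
     let J := usual_complex R s in
     let T : tensor4 R (s + s) := fun x y z w =>
       c0 * curv_sa 1%:M x y z w + c1 * curv_sk J x y z w in
     forall (pi : {vspace 'cV[R]_(s + s)}) (x y : 'cV[R]_(s + s)),
       complex_line J pi -> oriented_basis J pi x y ->
       has_eigenvalues J (JR J T x y)
         [:: (lam0, (s - 1)%N); (lam1, 1%N)])
  /\
  (exists c0 c1 c2 c3 : R,
     let J := quat_complex R s in
     let T : tensor4 R (s + s + (s + s)) := fun x y z w =>
       c0 * curv_sa 1%:M x y z w + c1 * curv_sk (quat_i R s) x y z w
       + c2 * curv_sk (quat_j R s) x y z w
       + c3 * curv_sk (quat_k R s) x y z w in
     forall (pi : {vspace 'cV[R]_(s + s + (s + s))})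
         (x y : 'cV[R]_(s + s + (s + s))),
       complex_line J pi -> oriented_basis J pi x y ->
       has_eigenvalues J (JR J T x y)
         [:: (lam0, (2 * s - 2)%N); (lam1, 2%N)])
  /\
  (exists c0 c1 c2 c3 : R,
     let J := quat_complex R s in
     let T : tensor4 R (s + s + (s + s)) := fun x y z w =>
       c0 * curv_sa 1%:M x y z w + c1 * curv_sk (quat_i R s) x y z w
       + c2 * curv_sk (quat_j R s) x y z w
       + c3 * curv_sk (quat_k R s) x y z w in
     forall (pi : {vspace 'cV[R]_(s + s + (s + s))})
         (x y : 'cV[R]_(s + s + (s + s))),
       complex_line J pi -> oriented_basis J pi x y ->
       has_eigenvalues J (JR J T x y)
         [:: (lam0, (2 * s - 2)%N); (lam1, 1%N); (lam2, 1%N)]).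
Proof.
split; [|split].
- exists (lam1 - 3 / 2 * lam0), (lam0 / 2) => J T pi x y _.
  exact: has_eigenvalues_complex_space_form.
(* With [mu1 = mu2 = lam1] the two lines span one eigenspace of dimension 2. *)
- exists (lam1 - 3 / 2 * lam0), (lam0 / 2), (lam0 - lam1), 0 => J T pi x y _.
  apply: has_eigenvalues_quaternionic; rewrite ?inE ?eqxx ?orbT // 1?eq_sym //.
  move=> p; rewrite !inE => /orP[] /eqP -> /=; first by rewrite eqxx.
  by rewrite eq_sym (negPf h01) eqxx.
(* Here [mu1 = lam1] and [mu2 = lam2]. *)
- exists (lam1 - 3 / 2 * lam0), (lam0 / 2), (lam0 - lam2), 0 => J T pi x y _.
  apply: has_eigenvalues_quaternionic; rewrite ?inE ?eqxx ?orbT // 1?eq_sym //.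
  move=> p; rewrite !inE => /or3P[] /eqP -> /=; first by rewrite eqxx.
    by rewrite eq_sym (negPf h01) eqxx eq_sym (negPf h12).
  by rewrite eq_sym (negPf h02) eqxx (negPf h12).
Qed.
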